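(* Let $X$ and $Y$ be compact Hausdorff spaces. Let $0<\epsilon<1/4$. Suppose that $Y$ has at least two points and that $X$ is infinite. Then for each $t<1$ there exists an $\epsilon$-disjointness preserving operator $T:C(X)\to C(Y)$ with $\|T\|=1$ such that there is no weighted composition map $S:C(X)\to C(Y)$ with $\|T-S\|<2t\sqrt{\epsilon}$. Furthermore, if $X$ admits an atomless regular Borel probability measure, then there exists an $\epsilon$-disjointness preserving operator $T:C(X)\to C(Y)$ with $\|T\|=1$ such that there is no weighted composition map $S:C(X)\to C(Y)$ with $\|T-S\|<2\sqrt{\epsilon}$.
   Context: $\mathbb{K}$ denotes $\mathbb{R}$ or $\mathbb{C}$. For a compact Hausdorff space $Z$, $C(Z)$ is the Banach space of $\mathbb{K}$-valued continuous functions on $Z$ with the sup norm $\|\cdot\|_\infty$; norms of operators are operator norms. For $\epsilon>0$, an operator $T:C(X)\to C(Y)$ is $\epsilon$-disjointness preserving if it is linear, continuous, and $\|(Tf)(Tg)\|_\infty\le\epsilon$ whenever $f,g\in C(X)$ satisfy $\|f\|_\infty=\|g\|_\infty=1$ and $fg\equiv 0$. An operator $S:C(X)\to C(Y)$ is a weighted composition map if there exist $a\in C(Y)$ and a map $h:Y\to X$, continuous on $c(a):=\{y\in Y:a(y)\ne 0\}$, such that $(Sf)(y)=a(y)f(h(y))$ for every $f\in C(X)$ and $y\in Y$ (the case $S\equiv 0$ is included). *)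

(* Defs.v *)
From HB Require Import structures.
From mathcomp Require Import all_boot all_order all_algebra.
From mathcomp Require Import complex.
From mathcomp Require Import all_classical all_reals all_analysis.

Set Implicit Arguments.
Unset Strict Implicit.
Unset Printing Implicit Defensive.

Import Order.TTheory GRing.Theory Num.Theory.
Import numFieldNormedType.Exports.

Local Open Scope classical_set_scope.
Local Open Scope ring_scope.

(* A [numFieldType] has its norm in itself, so on R[i] the library norm is a
   complex number. [modulus] is the same norm, read as a real number, and
   [of_real] is the inclusion of the reals (see [normE]). *)

Variant base_field := RealNumbers | ComplexNumbers.

Definition scalar_field (R : realType) (k : base_field) : numFieldType :=
  match k with
  | RealNumbers => R
  | ComplexNumbers => R[i]
  end.

Definition of_real (R : realType) (k : base_field) : R -> scalar_field R k :=
  match k with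
  | RealNumbers => fun r => r
  | ComplexNumbers => fun r => r%:C%C
  end.

Definition modulus (R : realType) (k : base_field) : scalar_field R k -> R :=
  match k with
  | RealNumbers => fun z : R => `|z|
  | ComplexNumbers => fun z : R[i] => complex.Re `|z|
  end.

Arguments of_real {R k}.
Arguments modulus {R k}.

Section scalar_theory.
Context (R : realType) (k : base_field).
Implicit Types (z w : scalar_field R k) (r s : R).

Lemma normE z : `|z| = of_real (modulus z).
Proof. by case: k z => //= z; rewrite RRe_real // normr_real. Qed.

Lemma of_realD r s :
  of_real (r + s) = of_real r + of_real s :> scalar_field R k.
Proof. by case: k => //=; rewrite rmorphD. Qed.

Lemma of_realM r s :
  of_real (r * s) = of_real r * of_real s :> scalar_field R k.
Proof. by case: k => //=; rewrite rmorphM. Qed.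

Lemma of_real0 : of_real 0 = 0 :> scalar_field R k.
Proof. by case: k. Qed.

Lemma ler_of_real r s : (of_real r <= of_real s :> scalar_field R k) = (r <= s).
Proof. by case: k => //=; rewrite lecR. Qed.

Lemma of_real_inj : injective (@of_real R k).
Proof. by case: k => //= r s []. Qed.

Lemma modulus_ge0 z : 0 <= modulus z.
Proof. by rewrite -ler_of_real -normE of_real0. Qed.

Lemma modulus0 : modulus (0 : scalar_field R k) = 0.
Proof. by apply: of_real_inj; rewrite -normE normr0 of_real0. Qed.

Lemma modulus0_eq0 z : modulus z = 0 -> z = 0.
Proof. by move=> z0; apply/eqP; rewrite -normr_eq0 normE z0 of_real0. Qed.

Lemma ler_modulusD z w : modulus (z + w) <= modulus z + modulus w.
Proof. by rewrite -ler_of_real of_realD -!normE ler_normD. Qed.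

Lemma modulusM z w : modulus (z * w) = modulus z * modulus w.
Proof. by apply: of_real_inj; rewrite of_realM -!normE normrM. Qed.

Lemma modulus_continuous : continuous (@modulus R k).
Proof.
move=> z; apply/(@cvgrPdist_lt _ _ _ (nbhs z)) => e e0.
have e0' : 0 < of_real e :> scalar_field R k.
  rewrite lt_neqAle eq_sym -of_real0 ler_of_real (inj_eq of_real_inj).
  by rewrite gt_eqF // ltW.
have := @cvgr_dist_lt (scalar_field R k) (scalar_field R k) (scalar_field R k)
  (nbhs z) (nbhs_filter z) id z (@cvg_id _ (nbhs z)) _ e0'.
move=> zw; apply: (@filterS _ _ (nbhs_filter z) _ _ _ zw) => w /= {zw}.
rewrite normE lt_neqAle ler_of_real (inj_eq of_real_inj) -lt_neqAle.
apply: le_lt_trans.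
have mB a b : modulus a - modulus b <= modulus (a - b : scalar_field R k).
  by rewrite lerBlDr -[X in modulus X <= _](subrK b) ler_modulusD.
have mN a b : modulus (a - b : scalar_field R k) = modulus (b - a).
  by apply: of_real_inj; rewrite -!normE distrC.
by rewrite ler_norml lerNl opprB {1}mN !mB.
Qed.

End scalar_theory.

Definition sup_norm (R : realType) (k : base_field) (Z : Type)
  (f : Z -> scalar_field R k) : R := sup [set modulus (f z) | z in setT].

(* The Banach space C(Z). Compactness of Z is a parameter of the type because
   the sup norm is finite, hence a norm, only thanks to it. The topology put on
   it below is the one of the sup norm. *)
Definition contfun (R : realType) (k : base_field) (Z : topologicalType)
  (cZ : compact [set: Z]) : Type := continuousType Z (scalar_field R k).

Section contfun_normedModType.
Context (R : realType) (k : base_field) (Z : topologicalType).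
Context (cZ : compact [set: Z]).
Local Notation K := (scalar_field R k).
Local Notation CZ := (contfun R k cZ).

HB.instance Definition _ := Choice.copy CZ (continuousType Z K).

Definition contfun_fun (f : CZ) : Z -> K := Continuous.sort f.

Coercion contfun_fun : contfun >-> Funclass.

Lemma contfunP (f g : CZ) : (forall z, f z = g z) -> f = g.
Proof. by move=> fg; apply/continuousEP. Qed.

Lemma contfun_continuous (f : CZ) : continuous (f : Z -> K).
Proof. exact: (@cts_fun _ _ (f : continuousType Z K)). Qed.

Definition mkcontfun (f : Z -> K) (cf : continuous f) : CZ :=
  (mkcts cf : continuousType Z K).

Lemma contfun_zero_subproof : continuous (fun _ : Z => 0 : K).
Proof. by move=> z; exact: cvg_cst. Qed.

Lemma contfun_opp_subproof (f : CZ) : continuous (fun z => - f z).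
Proof. by move=> z; apply: continuousN; exact: contfun_continuous. Qed.

Lemma contfun_add_subproof (f g : CZ) : continuous (fun z => f z + g z).
Proof. by move=> z; apply: continuousD; exact: contfun_continuous. Qed.

Lemma contfun_scale_subproof (c : K) (f : CZ) : continuous (fun z => c * f z).
Proof.
by move=> z; apply: continuousM;
  [exact: cst_continuous|exact: contfun_continuous].
Qed.

Definition contfun_zero := mkcontfun contfun_zero_subproof.
Definition contfun_opp (f : CZ) := mkcontfun (@contfun_opp_subproof f).
Definition contfun_add (f g : CZ) := mkcontfun (@contfun_add_subproof f g).
Definition contfun_scale (c : K) (f : CZ) :=
  mkcontfun (@contfun_scale_subproof c f).

Lemma contfun_addA : associative contfun_add.
Proof. by move=> f g h; apply: contfunP => z; exact: addrA. Qed.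

Lemma contfun_addC : commutative contfun_add.
Proof. by move=> f g; apply: contfunP => z; exact: addrC. Qed.

Lemma contfun_add0 : left_id contfun_zero contfun_add.
Proof. by move=> f; apply: contfunP => z; exact: add0r. Qed.

Lemma contfun_addN : left_inverse contfun_zero contfun_opp contfun_add.
Proof. by move=> f; apply: contfunP => z; exact: addNr. Qed.

HB.instance Definition _ := GRing.isZmodule.Build CZ
  contfun_addA contfun_addC contfun_add0 contfun_addN.

Lemma contfun_scaleA c d (f : CZ) :
  contfun_scale c (contfun_scale d f) = contfun_scale (c * d) f.
Proof. by apply: contfunP => z; exact: mulrA. Qed.

Lemma contfun_scale1 : left_id 1 contfun_scale.
Proof. by move=> f; apply: contfunP => z; exact: mul1r. Qed.

Lemma contfun_scaleDr : right_distributive contfun_scale +%R.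
Proof. by move=> c f g; apply: contfunP => z; exact: mulrDr. Qed.

Lemma contfun_scaleDl (f : CZ) :
  {morph contfun_scale^~ f : c d / c + d >-> c + d}.
Proof. by move=> c d; apply: contfunP => z; exact: mulrDl. Qed.

HB.instance Definition _ := GRing.Zmodule_isLmodule.Build K CZ
  contfun_scaleA contfun_scale1 contfun_scaleDr contfun_scaleDl.

Lemma contfun_has_ub (f : CZ) : has_ubound [set modulus (f z) | z in setT].
Proof.
have cf : {within [set: Z], continuous (modulus \o f)}.
  apply: continuous_subspaceT => z.
  apply: continuous_comp; first exact: contfun_continuous.
  exact: modulus_continuous.
have [M [_ MP]] := compact_bounded (continuous_compact cf cZ).
exists (M + 1) => _ [z _ <-].
have M1 : M < M + 1 by rewrite ltrDl.
rewrite (le_trans (ler_norm _))// (MP _ M1)//.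
Qed.

Lemma sup_norm_ub (f : CZ) z : modulus (f z) <= sup_norm f.
Proof. by apply: ub_le_sup; [exact: contfun_has_ub|exists z]. Qed.

Lemma sup_norm_le (f : Z -> K) r :
  0 <= r -> (forall z, modulus (f z) <= r) -> sup_norm f <= r.
Proof.
move=> r0 fr; rewrite /sup_norm.
have [->|/set0P ne] := eqVneq [set modulus (f z) | z in setT] set0.
  by rewrite sup0.
by apply: ge_sup => // _ [z _ <-].
Qed.

Lemma sup_norm_ge0 (f : CZ) : 0 <= sup_norm f.
Proof.
rewrite /sup_norm.
have [->|/set0P [_ [z _ _]]] := eqVneq [set modulus (f z) | z in setT] set0.
  by rewrite sup0.
by rewrite (le_trans (modulus_ge0 (f z)))// sup_norm_ub.
Qed.

Definition contfun_norm (f : CZ) : K := of_real (sup_norm f).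

Lemma contfun_ler_normD (f g : CZ) :
  contfun_norm (f + g) <= contfun_norm f + contfun_norm g.
Proof.
rewrite -of_realD ler_of_real; apply: sup_norm_le => [|z].
  by rewrite addr_ge0 ?sup_norm_ge0.
by rewrite (le_trans (ler_modulusD _ _))// lerD ?sup_norm_ub.
Qed.

Lemma contfun_normrZ c (f : CZ) : contfun_norm (c *: f) = `|c| * contfun_norm f.
Proof.
have le (d : K) (g : CZ) : sup_norm (d *: g) <= modulus d * sup_norm g.
  apply: sup_norm_le => [|z].
    by rewrite mulr_ge0 ?modulus_ge0 ?sup_norm_ge0.
  by rewrite modulusM ler_wpM2l ?modulus_ge0 ?sup_norm_ub.
rewrite normE -of_realM; congr of_real; apply/eqP; rewrite eq_le le /=.
have [->|c0] := eqVneq c 0; first by rewrite modulus0 mul0r sup_norm_ge0.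
have c0' : 0 < modulus c.
  rewrite lt_neqAle modulus_ge0 andbT eq_sym.
  by apply: contra_neq c0; exact: modulus0_eq0.
rewrite mulrC -ler_pdivlMr//.
have := le c^-1 (c *: f); rewrite scalerA mulVf// scale1r mulrC.
suff -> : modulus c^-1 = (modulus c)^-1 by [].
apply: (mulfI (lt0r_neq0 c0')); rewrite -modulusM mulfV// mulfV ?lt0r_neq0//.
by apply: (@of_real_inj R k); rewrite -normE normr1; case: k.
Qed.

Lemma contfun_normr0_eq0 (f : CZ) : contfun_norm f = 0 -> f = 0.
Proof.
rewrite -of_real0 => /of_real_inj f0; apply: contfunP => z.
apply: modulus0_eq0; apply/eqP.
by rewrite eq_le modulus_ge0 andbT -f0 sup_norm_ub.
Qed.

HB.instance Definition _ := @Lmodule_isNormed.Build K CZ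
  contfun_norm contfun_ler_normD contfun_normrZ contfun_normr0_eq0.

End contfun_normedModType.

(* [sup] is 0 on sets that are not bounded above, so [op_norm] is meaningful for
   bounded operators only; continuous linear maps and weighted composition maps
   are bounded. *)
Definition op_norm (R : realType) (k : base_field) (X Y : topologicalType)
    (cX : compact [set: X]) (cY : compact [set: Y])
    (T : contfun R k cX -> contfun R k cY) : R :=
  sup [set sup_norm (T f) | f in [set f : contfun R k cX | sup_norm f <= 1]].

Definition eps_disjointness_preserving (R : realType) (k : base_field)
    (X Y : topologicalType) (cX : compact [set: X]) (cY : compact [set: Y])
    (eps : R) (T : {linear contfun R k cX -> contfun R k cY}) : Prop :=
  continuous T /\
  forall f g : contfun R k cX, sup_norm f = 1 -> sup_norm g = 1 ->
    (forall x, f x * g x = 0) -> sup_norm (fun y => T f y * T g y) <= eps.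

Definition weighted_composition (R : realType) (k : base_field)
    (X Y : topologicalType) (cX : compact [set: X]) (cY : compact [set: Y])
    (S : contfun R k cX -> contfun R k cY) : Prop :=
  exists (a : contfun R k cY) (h : Y -> X),
    {within [set y | a y != 0], continuous h} /\
    forall f y, S f y = a y * f (h y).

(* A [measurableType] is a pointed type, whence the base point on X. *)
Definition borel (X : ptopologicalType) := g_sigma_algebraType (@open X).

Definition regular_measure (R : realType) (X : ptopologicalType)
    (mu : {measure set (borel X) -> \bar R}) : Prop :=
  forall A : set (borel X), measurable A ->
    mu A = ereal_sup
      [set mu C | C in [set C : set X | compact C /\ C `<=` A]] /\
    mu A = ereal_inf
      [set mu U | U in [set U : set X | open U /\ A `<=` U]].

Definition atomless (R : realType) d (T : measurableType d)
    (mu : {measure set T -> \bar R}) : Prop :=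
  forall A, measurable A -> (0 < mu A)%E ->
    exists B, [/\ measurable B, B `<=` A, (0 < mu B)%E & (mu B < mu A)%E].

(* Main.v *)
From HB Require Import structures.
Require Import Defs.
From mathcomp Require Import all_boot all_order all_algebra.
From mathcomp Require Import complex ring lra.
From mathcomp Require Import all_classical all_reals all_analysis.
From mathcomp Require Import measurable_realfun.
Import Order.TTheory GRing.Theory Num.Theory.
Import numFieldNormedType.Exports.
Local Open Scope classical_set_scope.
Local Open Scope ring_scope.

(* Let mu be a probability measure on X in which points have small mass: the
   uniform measure on n points, or an atomless regular measure. If f and g have
   norm 1 and disjoint supports, then the integrals of |f| and |g| add up to at
   most 1, so their product is at most 1/4 and L f := 2 sqrt eps (integral of f)
   satisfies |L f| |L g| <= eps. On the other hand, L is almost at distance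
   2 sqrt eps from every a delta_x: test it on a function that vanishes at x and
   is 1 outside a small neighbourhood of x. The operator T is L at one point of
   Y and a point evaluation, which gives it norm 1, at another. *)

(** * Coordinates of scalars, uniformly over both fields *)

Definition re_part {R : realType} {k : base_field} : scalar_field R k -> R :=
  match k with
  | RealNumbers => fun z : R => z
  | ComplexNumbers => fun z : R[i] => complex.Re z
  end.

Definition im_part {R : realType} {k : base_field} : scalar_field R k -> R :=
  match k with
  | RealNumbers => fun=> 0
  | ComplexNumbers => fun z : R[i] => complex.Im z
  end.

(** Over the reals the second coordinate is dropped, so that computations by coordinates cover both
    fields at once. *)
Definition of_parts {R : realType} {k : base_field} :
    R -> R -> scalar_field R k :=
  match k with
  | RealNumbers => fun a _ => a
  | ComplexNumbers => fun a b => (a +i* b)%C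
  end.

Section scalar_parts.
Context {R : realType} {k : base_field}.
Local Notation K := (scalar_field R k).
Implicit Types (z w : K) (r s a b : R).

Lemma of_real1 : of_real 1 = 1 :> K.
Proof. by case: k. Qed.

Lemma modulus1 : modulus (1 : K) = 1.
Proof. by apply: (@of_real_inj R k); rewrite -normE normr1 of_real1. Qed.

Lemma modulus_of_real r : modulus (of_real r : K) = `|r|.
Proof.
case: k; first by [].
by rewrite /modulus /of_real normc_def /= expr0n addr0 sqrtr_sqr.
Qed.

Lemma ler_modulusB z w : modulus (z - w) <= modulus z + modulus w.
Proof.
suff <- : modulus (- w) = modulus w by exact: ler_modulusD.
by apply: (@of_real_inj R k); rewrite -!normE normrN.
Qed.

Lemma sqr_modulus z : modulus z ^+ 2 = re_part z ^+ 2 + im_part z ^+ 2.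
Proof.
case: k z => z; first by rewrite /= real_normK ?num_real// expr0n addr0.
by rewrite /modulus normc_def /= sqr_sqrtr// addr_ge0 ?sqr_ge0.
Qed.

Lemma re_partD z w : re_part (z + w) = re_part z + re_part w.
Proof. by case: k z w => //= -[? ?] [? ?]. Qed.

Lemma im_partD z w : im_part (z + w) = im_part z + im_part w.
Proof. by case: k z w => [? ?|[? ?] [? ?]] //=; rewrite addr0. Qed.

Lemma re_partM z w :
  re_part (z * w) = re_part z * re_part w - im_part z * im_part w.
Proof. by case: k z w => [? ?|[? ?] [? ?]] //=; rewrite mulr0 subr0. Qed.

Lemma im_partM z w :
  im_part (z * w) = re_part z * im_part w + im_part z * re_part w.
Proof. by case: k z w => [? ?|[? ?] [? ?]] //=; rewrite mulr0 mul0r addr0. Qed.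

Lemma re_part_of_real r : re_part (of_real r : K) = r.
Proof. by case: k. Qed.

Lemma im_part_of_real r : im_part (of_real r : K) = 0.
Proof. by case: k. Qed.

Lemma of_partsr0 r : of_parts r 0 = of_real r :> K.
Proof. by case: k. Qed.

Lemma of_partsD a b a' b' :
  of_parts (a + a') (b + b') = of_parts a b + of_parts a' b' :> K.
Proof. by case: k. Qed.

(** This is the form needed to pull a scalar out of an integral computed by coordinates. Over the
    reals [im_part z] is 0 and [b] disappears. *)
Lemma of_partsM z a b :
  of_parts (re_part z * a - im_part z * b) (re_part z * b + im_part z * a) =
  z * of_parts a b.
Proof. by case: k z => [?|[? ?]] //=; rewrite mul0r subr0. Qed.

(** Keeping [a] and [b] visible on the right lets them be integrals that are linear in the
    integrand. Over the reals [b] is multiplied by 0. *)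
Lemma sqr_modulus_of_parts a b (z := of_parts a b : K) :
  modulus z ^+ 2 = re_part z * a + im_part z * b.
Proof.
by rewrite sqr_modulus /z; case: k => /=; rewrite ?expr0n ?mul0r -!expr2.
Qed.

(** The left side is the real part of [z] times the conjugate of [w]. Once it is positive, both
    sides can be squared, and by Lagrange's identity their difference is a square. *)
Lemma parts_CauchySchwarz z w :
  re_part z * re_part w + im_part z * im_part w <= modulus z * modulus w.
Proof.
have [n0|] := leP (re_part z * re_part w + im_part z * im_part w) 0.
  by rewrite (le_trans n0)// mulr_ge0 ?modulus_ge0.
move=> /ltW p0; rewrite -(@ler_pXn2r _ 2)// ?nnegrE ?mulr_ge0 ?modulus_ge0//.
rewrite exprMn !sqr_modulus -subr_ge0.
set a := re_part z; set b := im_part z; set c := re_part w; set d := im_part w.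
have -> : (a ^+ 2 + b ^+ 2) * (c ^+ 2 + d ^+ 2) - (a * c + b * d) ^+ 2 =
  (a * d - b * c) ^+ 2 by ring.
exact: sqr_ge0.
Qed.

Lemma ler_norm_re_part z : `|re_part z| <= modulus z.
Proof.
rewrite -(@ler_pXn2r _ 2)// ?nnegrE ?modulus_ge0//.
by rewrite sqr_modulus real_normK ?num_real// lerDl sqr_ge0.
Qed.

Lemma ler_norm_im_part z : `|im_part z| <= modulus z.
Proof.
rewrite -(@ler_pXn2r _ 2)// ?nnegrE ?modulus_ge0//.
by rewrite sqr_modulus real_normK ?num_real// lerDr sqr_ge0.
Qed.

Lemma continuous_le_modulus (p : K -> R) :
  (forall z w, `|p z - p w| <= modulus (z - w)) -> continuous p.
Proof.
move=> pP z; apply/(@cvgrPdist_lt _ _ _ (nbhs z)) => e e0.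
have : modulus (z - w) @[w --> z] --> modulus (z - z).
  apply: (@continuous_comp K K R (fun w => z - w) modulus z).
    by apply: (@cvgB K K K (nbhs z) _ (fun=> z) id);
      [exact: cvg_cst|exact: cvg_id].
  exact: modulus_continuous.
rewrite subrr modulus0 => /(@cvgr_dist_lt _ _ _ _ _) /(_ e e0).
apply: filterS => w /=; rewrite sub0r normrN => h.
by rewrite (le_lt_trans (pP _ _))// (le_lt_trans (ler_norm _)).
Qed.

Lemma re_part_continuous : continuous (re_part : K -> R).
Proof.
apply: continuous_le_modulus => z w.
have -> : re_part z - re_part w = re_part (z - w).
  by apply/eqP; rewrite subr_eq -re_partD subrK.
exact: ler_norm_re_part.
Qed.

Lemma im_part_continuous : continuous (im_part : K -> R).
Proof.
apply: continuous_le_modulus => z w.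
have -> : im_part z - im_part w = im_part (z - w).
  by apply/eqP; rewrite subr_eq -im_partD subrK.
exact: ler_norm_im_part.
Qed.

Lemma of_real_continuous : continuous (of_real : R -> K).
Proof.
move=> r; apply/(@cvgrPdist_lt _ _ _ (nbhs r)) => e e0.
(* The radius [e] lives in the scalar field; being positive, it is the image of a real number. *)
have eE : e = of_real (modulus e) by rewrite -normE gtr0_norm.
have e0' : 0 < modulus e.
  rewrite lt_neqAle modulus_ge0 andbT eq_sym.
  by apply: contraTneq e0 => /modulus0_eq0 ->; rewrite ltxx.
near=> s.
have rs : `|r - s| < modulus e.
  by near: s; exact: (@cvgr_dist_lt R R R (nbhs r) _ id r cvg_id _ e0').
have -> : of_real r - of_real s = of_real (r - s) :> K.
  by apply/eqP; rewrite subr_eq -of_realD subrK.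
rewrite normE eE modulus_of_real lt_neqAle (inj_eq (@of_real_inj R k)) ler_of_real.
by rewrite -lt_neqAle.
Unshelve. all: by end_near. Qed.

End scalar_parts.

(** * Scalar integrals of continuous functions against a probability measure *)

Section contfun_integral.
Context {R : realType} (k : base_field) {X : ptopologicalType}.
Context (cX : compact [set: X]) (mu : probability (borel X) R).
Local Notation K := (scalar_field R k).
Local Notation CX := (contfun R k cX).

Lemma open_measurable_borel (U : set X) :
  open U -> measurable (U : set (borel X)).
Proof. by move=> oU; apply: sub_sigma_algebra. Qed.

(** Open intervals generate the Borel sets of the line, and their preimages are open. *)
Lemma continuous_measurable_borel (h : X -> R) :
  continuous h -> measurable_fun [set: borel X] (h : borel X -> R).
Proof.
move=> ch; apply: (measurability _ (RGenOpens.measurableE R)).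
move=> _ [_ [a [b ->]] <-]; rewrite setTI; apply: open_measurable_borel.
by move/continuousP : ch; apply; exact: interval_open.
Qed.

Lemma continuous_integrable (h : X -> R) :
  continuous h -> mu.-integrable [set: borel X] (EFin \o h).
Proof.
move=> ch; apply: measurable_bounded_integrable => //.
- by apply: (le_lt_trans (probability_le1 mu measurableT)); rewrite ltry.
- exact: continuous_measurable_borel.
- have ch' : {within [set: X], continuous h} by apply: continuous_subspaceT.
  have := compact_bounded (continuous_compact ch' cX).
  move=> [M [Mr MP]]; exists M; split => // N MN x _.
  by apply: (MP N MN); exists x.
Qed.

Local Notation I h := (\int[mu]_x h x).

Lemma continuous_re (f : CX) : continuous (fun x => re_part (f x)).
Proof.
move=> x; apply: continuous_comp; first exact: contfun_continuous.
exact: re_part_continuous.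
Qed.

Lemma continuous_im (f : CX) : continuous (fun x => im_part (f x)).
Proof.
move=> x; apply: continuous_comp; first exact: contfun_continuous.
exact: im_part_continuous.
Qed.

Lemma continuous_modulus (f : CX) : continuous (fun x => modulus (f x)).
Proof.
move=> x; apply: continuous_comp; first exact: contfun_continuous.
exact: modulus_continuous.
Qed.

Let continuous_scale (a : R) (h : X -> R) :
  continuous h -> continuous (fun x => a * h x).
Proof. by move=> ch x; apply: continuousM; [exact: cst_continuous|]; exact: ch. Qed.

Let int_comb (a b : R) (g h : X -> R) : continuous g -> continuous h ->
  I (fun x => a * g x + b * h x) = a * I g + b * I h.
Proof.
move=> cg ch; rewrite RintegralD ?RintegralZl//; apply: continuous_integrable => //;
  exact: continuous_scale.
Qed.

(** Assembled from two real integrals, so that one definition serves both fields. *)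
Definition contfun_integral (f : CX) : K :=
  of_parts (I (fun x => re_part (f x))) (I (fun x => im_part (f x))).

Lemma contfun_integralD (f g : CX) :
  contfun_integral (f + g) = contfun_integral f + contfun_integral g.
Proof.
rewrite -of_partsD; congr of_parts; rewrite -RintegralD//;
  try (apply: continuous_integrable; by [exact: continuous_re|exact: continuous_im]);
  by apply: eq_Rintegral => x _; rewrite -?re_partD -?im_partD.
Qed.

Lemma contfun_integralZ c (f : CX) :
  contfun_integral (c *: f) = c * contfun_integral f.
Proof.
rewrite -of_partsM; congr of_parts.
  rewrite -mulNr -int_comb; [|exact: continuous_re|exact: continuous_im].
  by apply: eq_Rintegral => x _; rewrite re_partM mulNr.
rewrite -int_comb; [|exact: continuous_im|exact: continuous_re].
by apply: eq_Rintegral => x _; rewrite im_partM.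
Qed.

(** With [w] the integral of [f], the square of |w| is the integral of the real part of conj(w) f,
    hence at most |w| times the integral of |f|; then cancel |w|. *)
Lemma modulus_contfun_integral (f : CX) :
  modulus (contfun_integral f) <= I (fun x => modulus (f x)).
Proof.
set w := contfun_integral f.
have [w0|w0] := eqVneq (modulus w) 0.
  by rewrite w0 Rintegral_ge0// => x _; exact: modulus_ge0.
have {}w0 : 0 < modulus w by rewrite lt_neqAle eq_sym w0 modulus_ge0.
rewrite -(ler_pM2l w0) -expr2 sqr_modulus_of_parts -/w.
rewrite -int_comb; [|exact: continuous_re|exact: continuous_im].
have im := continuous_integrable _ (continuous_modulus f).
rewrite -RintegralZl//; apply: le_Rintegral => //.
- apply: continuous_integrable => x; apply: cvgD.
    by apply: continuous_scale; exact: continuous_re.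
  by apply: continuous_scale; exact: continuous_im.
- by apply: continuous_integrable; apply: continuous_scale; exact: continuous_modulus.
- by move=> x _; exact: parts_CauchySchwarz.
Qed.

Lemma contfun_integral_le (f : CX) :
  modulus (contfun_integral f) <= sup_norm f.
Proof.
apply: (le_trans (modulus_contfun_integral f)).
have -> : sup_norm f = I (fun=> sup_norm f).
  by rewrite Rintegral_cst//= probability_setT mulr1.
apply: le_Rintegral => //.
- exact: continuous_integrable (continuous_modulus f).
- by apply: continuous_integrable => x; exact: cvg_cst.
- by move=> x _; exact: sup_norm_ub.
Qed.

Lemma contfun_integral_disjoint (f g : CX) :
  sup_norm f = 1 -> sup_norm g = 1 -> (forall x, f x * g x = 0) ->
  modulus (contfun_integral f) * modulus (contfun_integral g) <= 1 / 4.
Proof.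
move=> f1 g1 fg0.
have If := modulus_contfun_integral f; have Ig := modulus_contfun_integral g.
have cf := continuous_integrable _ (continuous_modulus f).
have cg := continuous_integrable _ (continuous_modulus g).
have : I (fun x => modulus (f x)) + I (fun x => modulus (g x)) <= 1.
  have <- : I (fun=> 1 : R) = 1.
    by rewrite Rintegral_cst//= probability_setT mulr1.
  rewrite -RintegralD//; apply: le_Rintegral => //.
  - by rewrite (_ : EFin \o _ = (EFin \o (fun x => modulus (f x))) \+
       (EFin \o (fun x => modulus (g x))))%E//; exact: integrableD.
  - by apply: continuous_integrable => x; exact: cvg_cst.
  (* At each point one of the two functions vanishes and the other is bounded by its norm 1. *)
  move=> x _; have /eqP := fg0 x; rewrite mulf_eq0 => /orP[] /eqP ->.
    by rewrite modulus0 add0r -g1 sup_norm_ub.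
  by rewrite modulus0 addr0 -f1 sup_norm_ub.
move: If Ig (modulus_ge0 (contfun_integral f)) (modulus_ge0 (contfun_integral g)).
move: (modulus _) (modulus _) => a b If Ig a0 b0 h.
(* The bound follows from 4ab = (a + b)^2 - (a - b)^2. *)
have : (a + b) ^+ 2 <= 1 by rewrite expr_le1// ?addr_ge0//; lra.
have := sqr_ge0 (a - b); nra.
Qed.

(** The function [g] dominates the indicator of the complement of [U], so its integral is at least
    the mass of that complement. The form as a sum avoids subtracting extended reals. *)
Lemma contfun_integral_ge_compl (f : CX) (g : X -> R) (U : set X) :
  open U -> (forall x, f x = of_real (g x)) -> (forall x, 0 <= g x) ->
  (forall x, ~ U x -> g x = 1) ->
  (mu U + (modulus (contfun_integral f))%:E >= 1)%E.
Proof.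
move=> oU fg g0 gU; have mU := open_measurable_borel _ oU.
have -> : contfun_integral f = of_real (I g).
  rewrite -of_partsr0; congr of_parts.
    by apply: eq_Rintegral => x _; rewrite fg re_part_of_real.
  rewrite (_ : (fun x => im_part (f x)) = cst 0).
    by rewrite Rintegral_cst// mul0r.
  by apply/funext => x; rewrite fg im_part_of_real.
have ig : mu.-integrable [set: borel X] (EFin \o g).
  rewrite (_ : g = fun x => re_part (f x)).
    exact: continuous_integrable (continuous_re f).
  by apply/funext => x; rewrite fg re_part_of_real.
rewrite modulus_of_real ger0_norm ?Rintegral_ge0//.
rewrite /Rintegral fineK ?(integrable_fin_num measurableT ig)//.
have <- : (mu U + mu (~` U) = 1)%E.
  rewrite -measureU ?setUv ?setICr//; first exact: probability_setT.
  exact: measurableC.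
rewrite leeD2l//.
have <- : (\int[mu]_x (\1_(~` U) x)%:E = mu (~` U))%E.
  by rewrite integral_indic ?setIT//; exact: measurableC.
apply: ge0_le_integral => //.
- apply/measurable_EFinP; apply: measurable_indic; exact: measurableC.
- exact: (measurable_int mu ig).
- move=> x _; rewrite lee_fin indicE; case: (boolP (x \in ~` U)) => //.
  by rewrite inE => /gU ->.
Qed.

End contfun_integral.

(** * Urysohn functions on compact Hausdorff spaces *)

Lemma compact_hausdorff_urysohn {R : realType} {Z : topologicalType} (A B : set Z) :
  compact [set: Z] -> hausdorff_space Z -> closed A -> closed B ->
  A `&` B = set0 ->
  exists f : Z -> R, [/\ continuous f, forall z, 0 <= f z <= 1,
    forall z, A z -> f z = 0 & forall z, B z -> f z = 1].
Proof.
move=> cZ hZ cA cB AB.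
have [f [cf fA fB f01]] :=
  @urysohn_ext_itv _ R (compact_normal hZ cZ) _ _ _ _ cA cB AB ltr01.
exists f; split => //.
- by move=> z; have /f01 : range f (f z) by exists z; rewrite //= in_itv.
- by move=> z Az; apply: fA; exists z.
- by move=> z Bz; apply: fB; exists z.
Qed.

(** * The operator built from a functional and a point evaluation *)

Section two_point_operator.
Context {R : realType} {k : base_field} {X Y : topologicalType}.
Context (cX : compact [set: X]) (cY : compact [set: Y]).
Local Notation K := (scalar_field R k).
Local Notation CX := (contfun R k cX).
Local Notation CY := (contfun R k cY).

Let one : CX := mkcontfun cX (@cst_continuous X K 1).

(** The point [x] witnesses that [X] is nonempty; over an empty space the supremum would be 0. *)
Let sup_norm_one (x : X) : sup_norm one = 1.
Proof.
apply/eqP; rewrite eq_le; apply/andP; split.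
  by apply: sup_norm_le => // z; rewrite modulus1.
by rewrite -[leLHS](@modulus1 R k); exact: (sup_norm_ub one x).
Qed.

(** The operator is [2 sqrt eps * alpha * L f + beta * f x1], where the cutoff [alpha] is 1 at [y0]
    and [beta] is 1 at [y1]. The bound 1/4 on disjoint functions, scaled by 4 eps, gives
    disjointness preservation; the last hypothesis on [L] keeps weighted composition maps away at
    [y0]. *)
Lemma two_point_operator (eps r : R) (y0 y1 : Y) (x1 : X) (L : CX -> K) :
  0 < eps -> eps < 1 / 4 -> hausdorff_space Y -> y0 <> y1 ->
  (forall f g : CX, L (f + g) = L f + L g) ->
  (forall c (f : CX), L (c *: f) = c * L f) ->
  (forall f : CX, modulus (L f) <= sup_norm f) ->
  (forall f g : CX, sup_norm f = 1 -> sup_norm g = 1 ->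
    (forall x, f x * g x = 0) -> modulus (L f) * modulus (L g) <= 1 / 4) ->
  (forall x s, s < r ->
    exists f : CX, [/\ sup_norm f <= 1, f x = 0 & s < modulus (L f)]) ->
  exists T : {linear CX -> CY},
    [/\ eps_disjointness_preserving eps T, op_norm T = 1 &
      ~ exists S : {linear CX -> CY}, weighted_composition S /\
          op_norm (fun f => T f - S f) < 2 * r * Num.sqrt eps].
Proof.
move=> eps_gt0 eps_lt hY y01 LD LZ L_le L_disjoint L_diffuse.
have [gam [cgam gam01 gam0 gam1]] : exists gam : Y -> R, [/\ continuous gam,
    forall y, 0 <= gam y <= 1, forall y, y = y0 -> gam y = 0 &
    forall y, y = y1 -> gam y = 1].
  have cl (y : Y) : closed [set y].
    exact: (accessible_closed_set1 (hausdorff_accessible hY)).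
  apply: (@compact_hausdorff_urysohn R Y [set y0] [set y1]) => //.
  by rewrite -subset0 => y [/= ->] /y01.
(* The cutoffs alpha and beta never meet, so that at each y the operator is a
   multiple of L or of the evaluation at x1. *)
pose alpha y : R := Num.max 0 (1 - 2 * gam y).
pose beta y : R := Num.max 0 (2 * gam y - 1).
have c2 : continuous (fun y => 2 * gam y).
  move=> y; apply: (@continuousM R Y (fun=> 2) gam y); first exact: cst_continuous.
  exact: cgam.
have pos_cont (g h : Y -> R) : continuous g -> continuous h ->
    continuous (fun y => Num.max 0 (g y - h y)).
  move=> cg ch y; apply: (@continuous_max R Y (fun=> 0) (fun y => g y - h y)).
    exact: cst_continuous.
  by apply: (@continuousB R R Y g h y); [exact: cg|exact: ch].
have calpha : continuous alpha.
  by apply: (pos_cont (fun=> 1)) => // y; exact: cst_continuous.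
have cbeta : continuous beta.
  by apply: (pos_cont _ (fun=> 1)) => // y; exact: cst_continuous.
have alpha0 y : 0 <= alpha y by rewrite /alpha le_max lexx.
have beta0 y : 0 <= beta y by rewrite /beta le_max lexx.
have alpha1 y : alpha y <= 1.
  by rewrite /alpha ge_max; have /andP[] := gam01 y; lra.
have beta1 y : beta y <= 1.
  by rewrite /beta ge_max; have /andP[] := gam01 y; lra.
have alphabeta y : alpha y = 0 \/ beta y = 0.
  have [h|h] := leP (gam y) (1 / 2).
    by right; apply/max_idPl; lra.
  by left; apply/max_idPl; lra.
(* The scale makes [c * c] times 1/4 equal to [eps], while [eps < 1 / 4] yields [c <= 1], so that
   [c] times [L] still has norm at most 1. *)
pose c := 2 * Num.sqrt eps.
have sqrt_gt0 : 0 < Num.sqrt eps by rewrite sqrtr_gt0.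
have c_gt0 : 0 < c by rewrite mulr_gt0.
have cc : c * c = 4 * eps.
  by rewrite /c; have := sqr_sqrtr (ltW eps_gt0); nra.
have c_le1 : c <= 1.
  rewrite -(@ler_pXn2r _ 2)// ?nnegrE ?(ltW c_gt0)// expr1n expr2 cc.
  lra.
pose T0 (f : CX) y : K :=
  of_real (c * alpha y) * L f + of_real (beta y) * f x1.
have cT0 f : continuous (T0 f).
  have creal (h : Y -> R) (z : K) : continuous h ->
      continuous (fun y => of_real (h y) * z).
    move=> ch y; apply: (@continuousM K Y (fun y => of_real (h y)) (fun=> z)).
      by apply: (@continuous_comp Y R K); [exact: ch|exact: of_real_continuous].
    exact: cst_continuous.
  move=> y; apply: (@continuousD K K Y); apply: creal => // {}y.
  by apply: (@continuousM R Y (fun=> c) alpha);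
    [exact: cst_continuous|exact: calpha].
(* One of the two terms is 0, so the modulus of the sum is exactly the sum of the moduli. *)
have T0E f y : alpha y = 0 \/ beta y = 0 ->
    modulus (T0 f y) = c * alpha y * modulus (L f) + beta y * modulus (f x1).
  rewrite /T0 => -[->|->].
    by rewrite mulr0 of_real0 !mul0r !add0r modulusM modulus_of_real ger0_norm.
  rewrite of_real0 !mul0r !addr0 modulusM modulus_of_real ger0_norm//.
  by rewrite mulr_ge0// ltW.
have T0_le f y : modulus (T0 f y) <= sup_norm f.
  rewrite T0E//.
  have h1 := L_le f; have h2 := sup_norm_ub f x1.
  have m1 := modulus_ge0 (L f); have m2 := modulus_ge0 (f x1).
  have := alphabeta y.
  have := alpha0 y; have := alpha1 y; have := beta0 y; have := beta1 y.
  move: (alpha y) (beta y) => a b b1 b0 a1 a0 [->|->].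
    rewrite mulr0 mul0r add0r (le_trans _ h2)//; nra.
  rewrite mul0r addr0 (le_trans _ h1)// ler_piMl//.
  by rewrite -[leRHS]mulr1 ler_pM// ltW.
pose T1 (f : CX) : CY := mkcontfun cY (cT0 f).
have linT : linear T1.
  move=> a f g; apply: contfunP => y /=.
  transitivity (of_real (c * alpha y) * (a * L f + L g) +
      of_real (beta y) * (a * f x1 + g x1)).
    by rewrite -LZ -LD.
  rewrite -[RHS]/(a * T0 f y + T0 g y) /T0 !mulrDr addrACA.
  by rewrite [_ * (a * L f)]mulrCA [_ * (a * f x1)]mulrCA.
have [T TE] : exists T : {linear CX -> CY}, forall f y, T f y = T0 f y.
  pose T : {linear CX -> CY} := HB.pack T1 (GRing.isLinear.Build _ _ _ _ T1 linT).
  by exists T.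
have T_le f : sup_norm (T f) <= sup_norm f.
  by apply: sup_norm_le => [|y]; [exact: sup_norm_ge0|rewrite TE; exact: T0_le].
exists T; split.
- split.
    apply: bounded_linear_continuous; apply/linear_boundedP.
    exists 1; split; first exact: real1.
    move=> M M1 f; apply: (@le_trans _ _ (1 * `|f|)).
      (* Both norms are [of_real] of a [sup_norm], so the inequality between scalars is the real
         inequality [T_le]. *)
      by rewrite mul1r; apply: etrans (T_le f); exact: ler_of_real.
    by apply: ler_wpM2r => //; exact: ltW.
  move=> f g f1 g1 fg0; apply: sup_norm_le => [|y]; first exact: ltW.
  (* Where [alpha] vanishes, the product is a multiple of [f x1 * g x1 = 0]; where [beta] vanishes,
     it is at most 4 eps times 1/4. *)
  rewrite modulusM !TE !T0E//; have [->|->] := alphabeta y.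
    rewrite mulr0 !mul0r !add0r mulrACA -modulusM fg0 modulus0 mulr0.
    exact: ltW.
  rewrite !mul0r !addr0 mulrACA.
  have h := L_disjoint _ _ f1 g1 fg0.
  apply: (@le_trans _ _ ((4 * eps) * (1 / 4))); last by lra.
  apply: ler_pM => //.
  + by rewrite mulr_ge0// mulr_ge0// ltW.
  + by rewrite mulr_ge0// modulus_ge0.
  + by rewrite mulrACA cc ler_piMr// ?mulr_ile1// mulr_ge0// ltW.
- apply/eqP; rewrite eq_le /op_norm; apply/andP; split.
    apply: ge_sup.
      exists (sup_norm (T 0)); exists 0 => //=.
      by apply: sup_norm_le => // z; rewrite modulus0.
    by move=> _ [f /= f1 <-]; exact: le_trans (T_le f) f1.
  (* The norm 1 is attained at the constant function 1, because at [y1] the operator is evaluation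
     at [x1]. *)
  apply: (@le_trans _ _ (sup_norm (T one))).
    apply: (le_trans _ (sup_norm_ub (T one) y1)).
    rewrite -[leRHS]/(modulus (T one y1)) TE T0E//.
    have -> : alpha y1 = 0 by rewrite /alpha gam1//; apply/max_idPl; lra.
    have -> : beta y1 = 1.
      by rewrite /beta gam1//; have -> : 2 * 1 - 1 = 1 :> R; [lra|apply/max_idPr].
    rewrite -[one x1]/(1 : K) modulus1; lra.
  apply: ub_le_sup.
    by exists 1 => _ [f /= f1 <-]; exact: le_trans (T_le f) f1.
  by exists one => //=; rewrite (sup_norm_one x1).
- move=> [S [[a [h [_ SE]]] TS]].
  set D := op_norm _ in TS.
  have D_ub (f : CX) : sup_norm f <= 1 -> sup_norm (T f - S f) <= D.
    move=> f1; apply: ub_le_sup; last by exists f.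
    (* A supremum dominates its members only when the set is bounded: [T] contributes at most 1 and
       [S] at most the norm of its weight. *)
    exists (1 + sup_norm a) => _ [g /= g1 <-].
    apply: sup_norm_le => [|y]; first by rewrite addr_ge0// sup_norm_ge0.
    rewrite -[leLHS]/(modulus (T g y - contfun_fun (S g : CY) y)).
    rewrite (le_trans (ler_modulusB _ _))//.
    rewrite lerD//.
      by rewrite TE (le_trans (T0_le _ _)).
    rewrite SE modulusM -[leRHS]mulr1 ler_pM ?modulus_ge0 ?sup_norm_ub//.
    by rewrite (le_trans (sup_norm_ub _ _)).
  have Dr : D / c < r.
    by rewrite ltr_pdivrMr// (lt_le_trans TS)// /c mulrCA mulrA.
  (* The test function vanishes at [h y0], which kills [S f] at [y0], where [T f] equals [c] times
     [L f]. This leads to the contradiction c |L f| <= D < c |L f|. *)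
  have [f [f1 fx0 Lf]] := L_diffuse (h y0) _ Dr.
  have := le_trans (sup_norm_ub _ y0) (D_ub f f1).
  rewrite -[leLHS]/(modulus (T f y0 - contfun_fun (S f : CY) y0)).
  rewrite SE fx0 mulr0 subr0 TE T0E//.
  have -> : alpha y0 = 1.
    by rewrite /alpha gam0// mulr0 subr0; apply/max_idPr.
  have -> : beta y0 = 0.
    by rewrite /beta gam0//; apply/max_idPl; lra.
  rewrite mul0r addr0 mulr1.
  by move: Lf; rewrite ltr_pdivrMr// mulrC => /lt_le_trans h' /h'; rewrite ltxx.
Qed.

End two_point_operator.

(** * Measures with small mass near points, and their operators *)

Lemma diffuse_measure_operator {R : realType} {k : base_field}
  {X : ptopologicalType} {Y : topologicalType}
  (cX : compact [set: X]) (hX : hausdorff_space X)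
  (cY : compact [set: Y]) (hY : hausdorff_space Y)
  (eps : R) (eps_gt0 : 0 < eps) (eps_lt : eps < 1 / 4)
  (Y2 : exists y1 y2 : Y, y1 <> y2)
  (mu : probability (borel X) R) (r : R) :
  (forall (x : X) s, s < r ->
    exists U : set X, [/\ open U, U x & (mu U < (1 - s)%:E)%E]) ->
  exists T : {linear contfun R k cX -> contfun R k cY},
    [/\ eps_disjointness_preserving eps T, op_norm T = 1 &
      ~ exists S : {linear contfun R k cX -> contfun R k cY},
          weighted_composition S /\
          op_norm (fun f => T f - S f) < 2 * r * Num.sqrt eps].
Proof.
move=> mu_small; have [y1 [y2 y12]] := Y2.
(* The functional is integration against [mu], used at [y1]; the evaluation used at [y2] is the one
   at the base point of [X]. *)
apply: (@two_point_operator R k X Y cX cY eps r y1 y2 point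
  (contfun_integral k cX mu)) => //.
- exact: contfun_integralD.
- exact: contfun_integralZ.
- exact: contfun_integral_le.
- exact: contfun_integral_disjoint.
move=> x s /(mu_small x)[U [oU Ux muU]].
(* The integral of this function is at least 1 minus the mass of [U], hence exceeds [s]. *)
have [g [cg g01 gx gU]] : exists g : X -> R, [/\ continuous g,
    forall z, 0 <= g z <= 1, forall z, z = x -> g z = 0 &
    forall z, (~` U) z -> g z = 1].
  apply: (@compact_hausdorff_urysohn R X [set x] (~` U)) => //.
  - exact: (accessible_closed_set1 (hausdorff_accessible hX)).
  - exact: open_closedC.
  - by rewrite -subset0 => z [/= ->].
have cf : continuous (fun z => of_real (g z) : scalar_field R k).
  move=> z; apply: (@continuous_comp X R (scalar_field R k)); first exact: cg.
  exact: of_real_continuous.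
exists (mkcontfun cX cf); split.
- apply: sup_norm_le => // z; rewrite modulus_of_real.
  by have /andP[g0 g1] := g01 z; rewrite ger0_norm.
- by rewrite /= -[LHS]/(of_real (g x)) gx// of_real0.
- have g0 z : 0 <= g z by have /andP[] := g01 z.
  have := @contfun_integral_ge_compl R k X cX mu (mkcontfun cX cf) g U oU
    (fun=> erefl) g0 gU.
  set m := modulus _.
  move=> h; have {}h : (1%:E < (1 - s)%:E + m%:E)%E.
    by apply: (le_lt_trans h); apply: lte_leD.
  by move: h; rewrite -EFinD lte_fin; lra.
Qed.

(** A subset of a singleton is empty or the whole singleton, so an atomless measure gives mass 0 to
    points; outer regularity then provides the open set. *)
Lemma regular_atomless_diffuse {R : realType} {X : ptopologicalType}
  (hX : hausdorff_space X) (mu : probability (borel X) R) (x : X) (e : \bar R) :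
  regular_measure mu -> atomless mu -> (0 < e)%E ->
  exists U : set X, [/\ open U, U x & (mu U < e)%E].
Proof.
move=> reg atl e0.
have mx : measurable ([set x] : set (borel X)).
  rewrite -[X in measurable X]setCK; apply: measurableC.
  apply: open_measurable_borel; apply: closed_openC.
  exact: (accessible_closed_set1 (hausdorff_accessible hX)).
have mux : mu [set x] = 0%E.
  apply/eqP; rewrite eq_le measure_ge0 andbT leNgt; apply/negP => /(atl _ mx).
  move=> [B [_ Bx]]; have [->|->] := subset_set1 Bx;
    first by rewrite measure0 ltxx.
  by rewrite ltxx.
have [_ inf0] := reg _ mx.
have := e0; rewrite -(etrans (esym inf0) mux)  =>
  /ereal_inf_lt[_ [U [oU xU] <-] Ue].
by exists U; split => //; exact: xU.
Qed.

(** The measure is uniform on [n.+1] distinct points, and [U] leaves out all of them except possibly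
    [x]. *)
Lemma infinite_hausdorff_diffuse (R : realType) {X : ptopologicalType}
  (hX : hausdorff_space X) (Xinf : infinite_set [set: X]) (n : nat) :
  exists mu : probability (borel X) R, forall x : X,
    exists U : set X, [/\ open U, U x & (mu U <= (n.+1%:R^-1)%:E)%E].
Proof.
have /infiniteP/ppcard_leP[f] := Xinf.
have finj : injective f by move=> i j; apply: inj; rewrite inE.
pose m := msum (fun i => \d_(f i : borel X)) n.+1 :
  {measure set (borel X) -> \bar R}.
(* The Dirac measure is the default of [mnormalize] for total mass 0 or infinity; the total mass
   here is [n.+1]. *)
pose mu : probability (borel X) R := mnormalize m (\d_(point : borel X)).
exists mu => x.
have mE A : m A = (\sum_(i < n.+1) \d_(f i : borel X) A)%E by [].
have mT : m setT = n.+1%:R%:E.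
  rewrite mE (eq_bigr (fun=> 1%:E)); last by move=> i _; rewrite diracT.
  by rewrite sumEFin sumr_const card_ord.
have muE A : mu A = (m A * (n.+1%:R^-1)%:E)%E.
  by rewrite /mu /= /mnormalize mT /= eqe pnatr_eq0.
(* A finite set is closed in a Hausdorff space, and removing [x] from it puts [x] in the
   complement. *)
pose F := [set f i | i in `I_n.+1] `\ x.
exists (~` F); split.
- apply: closed_openC; move/hausdorff_accessible: hX.
  move=> /accessible_finite_set_closed; apply.
  by apply: finite_setD; apply: finite_image; exact: finite_II.
- by move=> [_ /=]; apply.
rewrite muE -[leRHS]mul1e lee_pmul2r ?lte_fin ?invr_gt0//.
rewrite mE.
have FE (i : 'I_n.+1) : f i != x -> \d_(f i : borel X) (~` F) = 0%E :> \bar R.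
  move=> fix_; rewrite diracE memNset// => /(_ _); apply.
  by split; [exists i => //=|exact/eqP].
have [[i fi]|no] := pselect (exists i : 'I_n.+1, f i = x).
  (* By injectivity of [f], only the index [i] contributes, with mass at most 1 before
     normalization. *)
  rewrite (bigD1 i)//= big1 ?adde0.
    by rewrite diracE lee_fin; case: (_ \in _).
  by move=> j ji; apply: FE; rewrite -fi (inj_eq finj).
rewrite big1// => i _; apply: FE; apply/eqP => fi; apply: no; by exists i.
Qed.

Theorem theorem3p1 (R : realType) (k : base_field)
  (X : ptopologicalType) (Y : topologicalType)
  (cX : compact [set: X]) (hX : hausdorff_space X)
  (cY : compact [set: Y]) (hY : hausdorff_space Y)
  (eps : R) (eps_gt0 : 0 < eps) (eps_lt : eps < 1 / 4)
  (Y2 : exists y1 y2 : Y, y1 <> y2) (Xinf : infinite_set [set: X]) :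
  (forall t : R, t < 1 ->
    exists T : {linear contfun R k cX -> contfun R k cY},
      [/\ eps_disjointness_preserving eps T, op_norm T = 1 &
        ~ exists S : {linear contfun R k cX -> contfun R k cY},
            weighted_composition S /\
            op_norm (fun f => T f - S f) < 2 * t * Num.sqrt eps]) /\
  ((exists mu : probability (borel X) R, regular_measure mu /\ atomless mu) ->
    exists T : {linear contfun R k cX -> contfun R k cY},
      [/\ eps_disjointness_preserving eps T, op_norm T = 1 &
        ~ exists S : {linear contfun R k cX -> contfun R k cY},
            weighted_composition S /\
            op_norm (fun f => T f - S f) < 2 * Num.sqrt eps]).
Proof.
split=> [t t1|[mu [reg atl]]].
  have t0 : 0 < 1 - t by rewrite subr_gt0.
  (* With this choice [n.+1] exceeds the inverse of [1 - t], so each point has a neighbourhood of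
     mass below [1 - t], which is below [1 - s] for [s < t]. *)
  pose n := Num.truncn (1 - t)^-1.
  have [mu muP] := infinite_hausdorff_diffuse R hX Xinf n.
  apply: (diffuse_measure_operator _ _ _ _ _ _ _ _ mu) => // x s st.
  have [U [oU Ux muU]] := muP x; exists U; split => //.
  apply: (le_lt_trans muU); rewrite lte_fin.
  apply: (@lt_trans _ _ (1 - t)); last by lra.
  rewrite invf_plt ?posrE//.
  exact: truncnS_gt.
(* Neighbourhoods of arbitrarily small mass allow [r = 1], which removes the factor [t]. *)
have := @diffuse_measure_operator R k X Y cX hX cY hY eps eps_gt0 eps_lt Y2 mu 1.
rewrite mulr1; apply => x s s1.
by apply: regular_atomless_diffuse => //; rewrite lte_fin subr_gt0.
Qed.
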